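(* Let $f:\mathbb{R}^n\to\mathbb{R}$ be a continuously differentiable, $\gamma$-strongly quasiconvex function with modulus $\gamma>0$, and let $x^*=\mathrm{argmin}_{\mathbb{R}^n} f$. Suppose that there exists a constant $\kappa>0$ such that $$\langle \nabla f(x),x-x^*\rangle \ge \kappa\,(f(x)-f(x^* ))\quad\text{for all } x\in\mathbb{R}^n .$$ Let $\epsilon:[t_0,+\infty)\to\mathbb{R}^n$ satisfy $\int_{t_0}^{+\infty}\|\epsilon(t)\|^2\,dt<+\infty$. Let $$\alpha\in\left(0,\ \frac{\kappa+4}{4}\sqrt{\frac{\gamma}{2\kappa}}\right],\qquad \beta\in\left[0,\ \frac{\sqrt{2\alpha^2(\kappa+2)^4+27\gamma(\kappa+4)^3}-\sqrt{2}\,\alpha(\kappa+2)^2}{9\sqrt{2}\,\gamma(\kappa+4)}\right],$$ and let $x:[t_0,+\infty)\to\mathbb{R}^n$ be a solution of $$\ddot{x}(t)+\alpha\dot{x}(t)+\nabla f\big(x(t)+\beta\dot{x}(t)\big)=\epsilon(t).$$ Then the following hold. (i) $\lim_{t\to+\infty} f(x(t)+\beta\dot{x}(t))=f(x^* )$ and $\lim_{t\to+\infty}\|x(t)-x^*\|=\lim_{t\to+\infty}\|\dot{x}(t)\|=0$. (ii) If moreover, for some $p>0$, $\|\epsilon(t)\|=\mathcal{O}\left(\frac{1}{t^p}\right)$ as $t\to+\infty$, then, as $t\to+\infty$, $$f(x(t)+\beta\dot{x}(t))-f(x^* )=\mathcal{O}\left(\frac{1}{t^{2p}}\right),\qquad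 \|x(t)-x^*\|=\mathcal{O}\left(\frac{1}{t^{p}}\right),\qquad \|\dot{x}(t)\|=\mathcal{O}\left(\frac{1}{t^{p}}\right).$$
   Context: $\mathbb{R}^n$ carries the Euclidean inner product $\langle\cdot,\cdot\rangle$ and norm $\|\cdot\|$. A function $f:\mathbb{R}^n\to\mathbb{R}$ is $\gamma$-strongly quasiconvex with modulus $\gamma>0$ if for all $x,y\in\mathbb{R}^n$ and $\lambda\in[0,1]$, $f(\lambda y+(1-\lambda)x)\le\max\{f(y),f(x)\}-\lambda(1-\lambda)\frac{\gamma}{2}\|x-y\|^2$. A lower semicontinuous $\gamma$-strongly quasiconvex function on $\mathbb{R}^n$ has a unique minimizer, so $x^*=\mathrm{argmin}_{\mathbb{R}^n}f$ denotes that point. $t_0\in\mathbb{R}$ is the initial time; a solution is a twice continuously differentiable function on $[t_0,+\infty)$ satisfying the equation for all $t\ge t_0$ (so in particular $\epsilon$ is continuous). *)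

(* Defs.v *)
From HB Require Import structures.
From mathcomp Require Import all_boot all_order all_algebra.
From mathcomp Require Import all_classical all_reals all_analysis.
Import Order.TTheory GRing.Theory Num.Theory.
Import numFieldNormedType.Exports.
Set Implicit Arguments.
Unset Strict Implicit.
Unset Printing Implicit Defensive.
Local Open Scope classical_set_scope.
Local Open Scope ring_scope.

(* The library norm `|u| on 'rV[R]_n is the sup norm: it induces the same
   topology and the same differentiability, but quantitative statements must
   use [enorm]. *)
Definition dotp (R : realType) (n : nat) (u v : 'rV[R]_n) : R :=
  \sum_(i < n) u 0 i * v 0 i.

Definition enorm (R : realType) (n : nat) (u : 'rV[R]_n) : R :=
  Num.sqrt (dotp u u).

Definition gradient (R : realType) (n : nat) (f : 'rV[R]_n -> R)
    (x : 'rV[R]_n) : 'rV[R]_n :=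
  \row_(i < n) 'D_(delta_mx 0 i) f x.

Definition continuously_differentiable (R : realType) (n : nat)
    (f : 'rV[R]_n -> R) : Prop :=
  (forall x, differentiable f x) /\ continuous (gradient f).

Definition strongly_quasiconvex (R : realType) (n : nat) (gamma : R)
    (f : 'rV[R]_n -> R) : Prop :=
  forall (x y : 'rV[R]_n) (lambda : R), 0 <= lambda <= 1 ->
    f (lambda *: y + (1 - lambda) *: x) <=
      Num.max (f y) (f x)
      - lambda * (1 - lambda) * (gamma / 2) * enorm (x - y) ^+ 2.

Definition argmin (R : realType) (n : nat) (f : 'rV[R]_n -> R)
    : set 'rV[R]_n :=
  [set x | forall y, f x <= f y].

(* A function on [t0, +oo[ is represented by a total function on R whose values
   on ]-oo, t0[ are irrelevant.  Difference quotients at t >= t0 are therefore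
   taken along s >= t0 with s != t, so the derivative at t0 is the right
   derivative and no differentiability across t0 is required. *)
Definition diff_quotient_from (R : realType) (n : nat) (t0 : R)
    (x : R -> 'rV[R]_n) (t : R) : set_system 'rV[R]_n :=
  (fun s => (s - t)^-1 *: (x s - x t)) @ within `[t0, +oo[ (t^').

Definition derive_from (R : realType) (n : nat) (t0 : R)
    (x : R -> 'rV[R]_n) (t : R) : 'rV[R]_n :=
  lim (diff_quotient_from t0 x t).

Definition derivable_from (R : realType) (n : nat) (t0 : R)
    (x : R -> 'rV[R]_n) : Prop :=
  forall t, t0 <= t -> cvg (diff_quotient_from t0 x t).

Definition twice_continuously_differentiable_from (R : realType) (n : nat)
    (t0 : R) (x : R -> 'rV[R]_n) : Prop :=
  [/\ derivable_from t0 x,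
      derivable_from t0 (derive_from t0 x) &
      {within `[t0, +oo[, continuous (derive_from t0 (derive_from t0 x))}].

Definition is_solution (R : realType) (n : nat) (f : 'rV[R]_n -> R)
    (alpha beta t0 : R) (eps x : R -> 'rV[R]_n) : Prop :=
  twice_continuously_differentiable_from t0 x /\
  forall t, t0 <= t ->
    derive_from t0 (derive_from t0 x) t + alpha *: derive_from t0 x t
    + gradient f (x t + beta *: derive_from t0 x t) = eps t.

(* Lets the Landau notation [f =O_ +oo g] infer its filter. *)
Canonical pinfty_filter_on (R : numFieldType) :=
  FilterType (pinfty_nbhs R) (@filter_filter _ _ proper_pinfty_nbhs).

(* Main.v *)
Require Import Defs.
From HB Require Import structures.
From mathcomp Require Import all_boot all_order all_algebra.
From mathcomp Require Import all_classical all_reals all_analysis.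
From mathcomp Require Import measurable_realfun ring lra.
Import Order.TTheory GRing.Theory Num.Theory.
Import numFieldNormedType.Exports.
Local Open Scope classical_set_scope.
Local Open Scope ring_scope.
Set Implicit Arguments.
Unset Strict Implicit.
Unset Printing Implicit Defensive.

(** The theorem is a Lyapunov argument.  Write u = x - xstar, v = x',
    w = u + beta v for the displacement of the extrapolated point, g for the
    gradient of f there and F = f (x + beta v) - f xstar >= 0.  The energy

      E = F + (alpha ^ 2 / 4) |u| ^ 2 + (alpha / 2) (u | v)
            + ((1 + alpha beta + alpha beta / 2) / 2) |v| ^ 2

    dominates F, |u| ^ 2 and |v| ^ 2.  Along a solution, v' is
    eps - alpha v - g, and the derivative of E is

      - (alpha / 2) (g | w) - beta |g + alpha v| ^ 2
      - (alpha / 2 + alpha ^ 2 beta / 2) |v| ^ 2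
      + beta (g + alpha v | eps) + (alpha / 2) (w | eps) + (v | eps).

    The weight of |v| ^ 2 in E is chosen to produce the square
    |g + alpha v| ^ 2, which disposes of the only product of the forcing with
    the gradient, a quantity that nothing else in the estimate controls.
    Strong quasiconvexity at a midpoint gives F >= (gamma / 8) |w| ^ 2, and by
    assumption (g | w) >= kappa F.  Hence, by Young's inequality,

      E' <= - c E + K |eps| ^ 2     for some c > 0 and K >= 0

    ([energy_dissipation]).  Everything else is about this scalar inequality:
    an integrable |eps| ^ 2 makes E tend to 0 ([dissipation_cvg0]), and
    |eps| ^ 2 = O(t ^ (- 2 p)) gives E = O(t ^ (- 2 p))
    ([dissipation_bigO]).

    Derivatives are taken only at times strictly after t0, where they are
    two-sided ([is_derive_from]); the asymptotics do not see the endpoint. *)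

(** * Scalar dissipation inequalities *)

Section ScalarODE.
Context {R : realType}.
Implicit Types (a c k s t : R) (f df : R -> R).

Lemma derive_le_increment f df a k :
  (forall t, a < t -> is_derive t 1 f (df t)) ->
  (forall t, a < t -> df t <= k) ->
  forall s t, a < s -> s <= t -> f t - f s <= k * (t - s).
Proof.
move=> fdf dfk s t as_ st.
have [r|| r rst ->] := @MVT_segment R f df s t st.
- by rewrite in_itv/= => /andP[sr _]; apply: fdf; exact: lt_trans sr.
- apply: derivable_within_continuous => r; rewrite in_itv/= => /andP[sr _].
  exact: (@ex_derive _ _ _ _ _ _ _ (fdf r (lt_le_trans as_ sr))).
- rewrite ler_wpM2r ?subr_ge0// dfk//.
  by move: rst; rewrite in_itv/= => /andP[+ _]; exact: lt_le_trans.
Qed.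

(** With H a primitive of N, the function E - K H is nonincreasing and bounded
    below, and H is nondecreasing and bounded above; both thus converge, and so
    does E.  A positive limit of E would force E - K H to decrease at least
    linearly, against its lower bound. *)
Lemma dissipation_cvg0 (E dE H N : R -> R) (a c K B : R) :
  0 < c -> 0 <= K ->
  (forall t, a < t -> 0 <= E t) ->
  (forall t, a < t -> 0 <= N t) ->
  (forall t, a < t -> is_derive t 1 E (dE t)) ->
  (forall t, a < t -> is_derive t 1 H (N t)) ->
  (forall t, a < t -> H t <= B) ->
  (forall t, a < t -> dE t <= - c * E t + K * N t) ->
  E t @[t --> +oo] --> 0.
Proof.
move=> c0 K0 E0 N0 EdE HdH HB dEle.
pose G t := E t - K * H t.
have GdG t : a < t -> is_derive t 1 G (dE t - K * N t).
  move=> at_; have ? := EdE _ at_; have ? := HdH _ at_.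
  rewrite (_ : G = E - K *: H)//; exact: is_deriveB.
have Gle s t : a < s -> s <= t -> G t <= G s.
  move=> as_ st; rewrite -subr_le0 -[leRHS](mul0r (t - s)).
  apply: (derive_le_increment GdG) => // r ar.
  have := dEle _ ar; have := mulr_ge0 (ltW c0) (E0 _ ar); lra.
have Hle s t : a < s -> s <= t -> H s <= H t.
  move=> as_ st; rewrite -subr_le0.
  have := @derive_le_increment (- H) (- N) a 0 _ _ _ _ as_ st.
  rewrite mul0r /= opprK addrC; apply=> r ar.
    by have ? := HdH _ ar; exact: is_deriveN.
  by rewrite oppr_le0 N0.
have GB t : a < t -> - (K * B) <= G t.
  move=> at_; rewrite /G; have := E0 _ at_.
  have := ler_wpM2l K0 (HB _ at_); lra.
have a1 : a < a + 1 by rewrite ltrDl.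
have Gconst e : 0 < e -> exists2 s, a < s & forall t, s <= t -> G s <= G t + e.
  move=> e0; pose S := [set G t | t in [set t | a < t]].
  have Sinf : has_inf S.
    by split; [exists (G (a + 1)), (a + 1)|
      exists (- (K * B)) => _ [t at_ <-]; exact: GB].
  have [_ [s as_ <-] Gs] := inf_adherent e0 Sinf.
  exists s => // t st; apply: (le_trans (ltW Gs)); rewrite lerD2r.
  by apply: ge_inf; [case: Sinf|exists t => //; exact: lt_le_trans st].
have Hconst e : 0 < e -> exists2 s, a < s & forall t, s <= t -> H t <= H s + e.
  move=> e0; pose S := [set H t | t in [set t | a < t]].
  have Ssup : has_sup S.
    by split; [exists (H (a + 1)), (a + 1)|
      exists B => _ [t at_ <-]; exact: HB].
  have [_ [s as_ <-] Hs] := sup_adherent e0 Ssup.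
  exists s => // t st; rewrite -lerBlDr; apply: (le_trans _ (ltW Hs)).
  rewrite lerD2r.
  by apply: ub_le_sup; [case: Ssup|exists t => //; exact: lt_le_trans st].
apply/cvgrPdist_le => e e0.
have [s1 as1 Gs1] := Gconst (e / 4) ltac:(lra).
have K1 : 0 < K + 1 by lra.
have [s2 as2 Hs2] :=
  Hconst (e / 4 / (K + 1)) ltac:(by rewrite !divr_gt0//; lra).
pose s := Num.max s1 s2.
have s1s : s1 <= s by rewrite le_max lexx.
have s2s : s2 <= s by rewrite le_max lexx orbT.
have as_ : a < s := lt_le_trans as1 s1s.
near=> t.
have st : s <= t by near: t; apply: nbhs_pinfty_ge; exact: num_real.
have at_ := lt_le_trans as_ st.
rewrite sub0r normrN ger0_norm ?E0// leNgt; apply/negP => eE.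
(* G and H hardly move after s, so E t >= e keeps E above e / 2 forever *)
have Elow r : s <= r -> e / 2 <= E r.
  move=> sr.
  have EG q : E q = G q + K * H q by rewrite /G subrK.
  have G1 : G t <= G r + e / 4.
    apply: le_trans (Gs1 _ (le_trans s1s sr)).
    by apply: Gle => //; exact: le_trans st.
  have H1 : K * H t <= K * H r + e / 4.
    have : H t <= H r + e / 4 / (K + 1).
      apply: (le_trans (Hs2 _ (le_trans s2s st))); rewrite lerD2r.
      by apply: Hle => //; exact: le_trans sr.
    move=> /(ler_wpM2l K0) /le_trans; apply.
    rewrite mulrDr lerD2l mulrCA ler_piMr ?ler_pdivrMr//; lra.
  rewrite (EG r); move: eE; rewrite (EG t); lra.
have lin r : s + 1 <= r -> G r <= G (s + 1) - c * (e / 2) * (r - (s + 1)).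
  move=> sr; rewrite -lerBlDl -mulNr.
  apply: (@derive_le_increment G (fun t => dE t - K * N t) s) => //.
  - by move=> q sq; apply: GdG; exact: lt_trans sq.
  - move=> q sq; have aq := lt_trans as_ sq.
    have := dEle _ aq; have := ler_wpM2l (ltW c0) (Elow _ (ltW sq)); lra.
  - by rewrite ltrDl.
(* after this delay the linear bound would fall below - K * B *)
pose d := (G (s + 1) + K * B + 1) / (c * (e / 2)).
have ce : 0 < c * (e / 2) by rewrite mulr_gt0// divr_gt0.
have as1' : a < s + 1 by lra.
have d0 : 0 <= d by rewrite divr_ge0 ?(ltW ce)//; have := GB _ as1'; lra.
have := lin (s + 1 + d) ltac:(by rewrite lerDl).
rewrite (_ : s + 1 + d - (s + 1) = d) 1?mulrC ?divfK ?gt_eqF//; last by ring.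
have := GB (s + 1 + d) ltac:(lra); lra.
Unshelve. all: by end_near. Qed.

(** Put P t = E t * t ^ q.  Differentiating the weight costs (q / t) P, which
    is at most (c / 2) P for large t, so P' <= - (c / 2) P + K M there, and
    such a P is bounded. *)
Lemma dissipation_bigO (E dE N : R -> R) (a c K M q : R) :
  0 < c -> 0 <= K ->
  (forall t, a < t -> 0 <= E t) ->
  (forall t, a < t -> is_derive t 1 E (dE t)) ->
  (forall t, a < t -> dE t <= - c * E t + K * N t) ->
  (\forall t \near +oo, N t <= M * (t `^ q)^-1) ->
  exists M', \forall t \near +oo, E t <= M' * (t `^ q)^-1.
Proof.
move=> c0 K0 E0 EdE dEle [T [_ NM]].
pose s0 := Num.max (Num.max a T) (Num.max 0 (2 * q / c)).
have [as0 Ts0 s00 qs0] : [/\ a <= s0, T <= s0, 0 <= s0 & 2 * q / c <= s0].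
  by rewrite /s0 !le_max !lexx ?orbT.
pose P t := E t * t `^ q.
(* B is the equilibrium of P' = - (c / 2) P + K M, so expR (c / 2 * t) * (P - B)
   is nonincreasing *)
pose B := 2 * K * M / c.
pose W t := expR (c / 2 * t) * (P t - B).
pose dP t := E t * (q * t `^ (q - 1)) + t `^ q * dE t.
pose dW t := expR (c / 2 * t) * dP t + (P t - B) * (expR (c / 2 * t) * (c / 2)).
have PdP t : s0 < t -> is_derive t 1 P (dP t).
  move=> st; have t0 : 0 < t := le_lt_trans s00 st.
  have ? := EdE t (le_lt_trans as0 st); have ? := is_derive1_powR q t0.
  rewrite (_ : P = E * (fun x => x `^ q))//; exact: is_deriveM.
have WdW t : s0 < t -> is_derive t 1 W (dW t).
  move=> st; have ? := PdP _ st.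
  have ? : is_derive t 1 (expR \o (fun t => c / 2 * t))
      (expR (c / 2 * t) * (c / 2)).
    apply: is_derive1_comp.
    rewrite (_ : (fun t => _) = (c / 2) *: (@id R))//.
    rewrite -[X in is_derive _ _ _ X]mulr1; exact: is_deriveZ.
  have ? : is_derive t 1 (P - cst B) (dP t).
    by rewrite -[X in is_derive _ _ _ X]subr0; exact: is_deriveB.
  rewrite (_ : W = (expR \o (fun t => c / 2 * t)) * (P - cst B))//.
  exact: is_deriveM.
have dW0 t : s0 < t -> dW t <= 0.
  move=> st; have t0 : 0 < t := le_lt_trans s00 st.
  have tq : 0 < t `^ q by rewrite powR_gt0.
  have at_ := le_lt_trans as0 st.
  have -> : dW t = expR (c / 2 * t) * (dP t + c / 2 * (P t - B)).
    by rewrite /dW; ring.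
  rewrite pmulr_rle0 ?expR_gt0//.
  have -> : c / 2 * (P t - B) = c / 2 * P t - K * M.
    by rewrite /B; field; rewrite gt_eqF.
  have H1 : E t * (q * t `^ (q - 1)) <= c / 2 * P t.
    rewrite powRB ?powRr1 ?(ltW t0) ?(gt_eqF t0) ?implybT//.
    have -> : E t * (q * (t `^ q / t)) = (q / t) * P t by rewrite /P; ring.
    rewrite ler_wpM2r// ?mulr_ge0 ?E0 ?(ltW tq)// ler_pdivrMr//.
    have := le_lt_trans qs0 st; rewrite ltr_pdivrMr// => ?; lra.
  have H2 : t `^ q * dE t <= - c * P t + K * M.
    have : t `^ q * N t <= M.
      by rewrite mulrC -ler_pdivlMr// NM// (le_lt_trans Ts0).
    move=> /(ler_wpM2l K0); have := ler_wpM2l (ltW tq) (dEle _ at_).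
    rewrite /P; lra.
  rewrite /dP; lra.
exists (B + `|P (s0 + 1) - B|); near=> t.
have st : s0 + 1 <= t by near: t; apply: nbhs_pinfty_ge; exact: num_real.
have t0 : 0 < t by lra.
rewrite ler_pdivlMr ?powR_gt0// -/(P t) -lerBlDl.
have := derive_le_increment WdW dW0 (_ : s0 < s0 + 1) st.
rewrite mul0r subr_le0 => /(_ ltac:(by rewrite ltrDl)) Wt.
rewrite -(ler_pM2l (expR_gt0 (c / 2 * t))); apply: (le_trans Wt).
apply: (@le_trans _ _ (expR (c / 2 * (s0 + 1)) * `|P (s0 + 1) - B|)).
  by rewrite ler_pM2l ?expR_gt0// ler_norm.
by rewrite ler_wpM2r// ler_expR ler_pM2l// divr_gt0.
Unshelve. all: by end_near. Qed.

End ScalarODE.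

(** * Bounded primitives of integrable functions *)

(** Continuity is available only on the open ray, whereas the integral is over
    the closed one; the endpoint is negligible. *)
Lemma bounded_primitive_on_ray (R : realType) (N : R -> R) (a : R) :
  {in `]a, +oo[, continuous N} -> (forall t, a < t -> 0 <= N t) ->
  (\int[lebesgue_measure]_(t in `[a, +oo[) (N t)%:E < +oo)%E ->
  exists H : R -> R, exists B,
    (forall t, a < t -> is_derive t 1 H (N t)) /\
    (forall t, a < t -> H t <= B).
Proof.
move=> cN N0 Noo.
have mN : measurable_fun `]a, +oo[ N.
  by apply: open_continuous_measurable_fun => // x; rewrite inE; exact: cN.
have mEN : measurable_fun `]a, +oo[ (EFin \o N) by exact/measurable_EFinP.
have N0E x : `]a, +oo[%classic x -> (0 <= (N x)%:E)%E.
  by rewrite /= in_itv/= andbT lee_fin => /N0.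
have Noo' : (\int[lebesgue_measure]_(t in `]a, +oo[) (N t)%:E < +oo)%E.
  by rewrite integral_itv_obnd_cbnd.
have iN : lebesgue_measure.-integrable `]a, +oo[ (EFin \o N).
  apply/integrableP; split => //; under eq_integral => x.
    rewrite inE => ax; rewrite gee0_abs ?N0E//; over.
  by [].
have subitv t : `]a, t] `<=` `]a, +oo[ by exact: subset_itvl.
pose H t := \int[lebesgue_measure]_(x in `]a, t]) N x.
exists H, (fine (\int[lebesgue_measure]_(t in `]a, +oo[) (N t)%:E)).
split=> t at_.
  have [||||] := @continuous_FTC1 R N (BRight a) t (t + 1).
  - by rewrite ltrDl.
  - exact: integrableS iN.
  - exact: at_.
  - by apply: cN; rewrite in_itv/= andbT.
  - move=> dH dHE; apply: DeriveDef; [exact: dH|rewrite -derive1E; exact: dHE].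
apply: fine_le.
- by apply: integrable_fin_num => //; exact: integrableS iN.
- exact: integrable_fin_num.
- exact: ge0_subset_integral.
Qed.

(** * The energy and its dissipation *)

Section Energy.
Context {R : realType}.
Implicit Types (alpha beta gamma kappa : R).

Lemma dotp_ge0 n (u : 'rV[R]_n) : 0 <= dotp u u.
Proof. by apply: sumr_ge0 => i _; rewrite -expr2 sqr_ge0. Qed.

Lemma enorm_sqr n (u : 'rV[R]_n) : enorm u ^+ 2 = dotp u u.
Proof. by rewrite /enorm sqr_sqrtr// dotp_ge0. Qed.

(** The quadratic part of the Lyapunov function, one coordinate at a time; u
    stands for position minus minimizer and v for velocity.  The coefficient of
    v ^ 2 is tuned so that the rate of decay factors as in
    [coord_dissipation]. *)
Definition coord_energy alpha beta (u v : R) : R :=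
  alpha ^+ 2 / 4 * u ^+ 2 + alpha / 2 * (u * v)
  + (1 + alpha * beta + alpha * beta / 2) / 2 * v ^+ 2.

(** The time derivative of [coord_energy] when u' = v and v' = r. *)
Definition coord_energy_rate alpha beta (u v r : R) : R :=
  alpha ^+ 2 / 2 * (u * v) + alpha / 2 * (v ^+ 2 + u * r)
  + (1 + alpha * beta + alpha * beta / 2) * (v * r).

Lemma coord_energy_coercive alpha beta u v : 0 < alpha -> 0 <= beta ->
  alpha ^+ 2 / 16 * u ^+ 2 + v ^+ 2 / 6 <= coord_energy alpha beta u v.
Proof.
move=> a0 b0.
have := mulr_ge0 (mulr_ge0 (ltW a0) b0) (sqr_ge0 v).
(* splits the cross term as 3 / 16 of (alpha * u) ^ 2 and 1 / 3 of v ^ 2 *)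
have := sqr_ge0 (alpha * u * (3 / 4) + v).
rewrite /coord_energy !expr2; lra.
Qed.

(** The upper bound is in terms of u + beta v because growth of f controls
    the distance from the extrapolated point, not from u itself. *)
Lemma coord_energy_le alpha beta : 0 < alpha -> 0 <= beta ->
  exists2 A, 0 < A & forall u v,
    coord_energy alpha beta u v <= A * ((u + beta * v) ^+ 2 + v ^+ 2).
Proof.
move=> a0 b0; have ab := mulr_ge0 (ltW a0) b0.
exists ((alpha ^+ 2 / 2 + alpha / 2) * (1 + beta ^+ 2) + alpha / 4
        + (1 + alpha * beta + alpha * beta / 2) / 2).
  have := mulr_ge0 (_ : 0 <= alpha ^+ 2 / 2 + alpha / 2)
    (_ : 0 <= 1 + beta ^+ 2).
  move=> /(_ ltac:(have := sqr_ge0 alpha; lra)).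
  move=> /(_ ltac:(have := sqr_ge0 beta; lra)); lra.
move=> u v; set w := u + beta * v.
have -> : u = w - beta * v by rewrite /w; lra.
set k := alpha ^+ 2 / 4 + alpha / 4.
have k0 : 0 <= k by rewrite /k; have := sqr_ge0 alpha; lra.
set m := alpha / 4 + (1 + alpha * beta + alpha * beta / 2) / 2.
have m0 : 0 <= m by rewrite /m; lra.
have -> : coord_energy alpha beta (w - beta * v) v =
   k * (w - beta * v) ^+ 2 - alpha / 4 * (w - beta * v - v) ^+ 2 + m * v ^+ 2.
  by rewrite /coord_energy /k /m; field.
have -> : (alpha ^+ 2 / 2 + alpha / 2) * (1 + beta ^+ 2) + alpha / 4
        + (1 + alpha * beta + alpha * beta / 2) / 2
    = 2 * k * (1 + beta ^+ 2) + m by rewrite /k /m; field.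
have H1 : 0 <= alpha / 4 * (w - beta * v - v) ^+ 2.
  by rewrite mulr_ge0 ?sqr_ge0//; lra.
have H2 : 0 <= k * (w + beta * v) ^+ 2 by rewrite mulr_ge0 ?sqr_ge0.
have H3 : 0 <= k * v ^+ 2 by rewrite mulr_ge0 ?sqr_ge0.
have H4 : 0 <= k * (beta * w) ^+ 2 by rewrite mulr_ge0 ?sqr_ge0.
have H5 : 0 <= m * w ^+ 2 by rewrite mulr_ge0 ?sqr_ge0.
move: H1 H2 H3 H4 H5; rewrite !expr2; lra.
Qed.

(** The left-hand side is the derivative of energy along the equation.  With
    w = u + beta v it equals
      - (alpha / 2) g w - beta (g + alpha v) ^ 2
      - (alpha / 2 + alpha ^ 2 beta / 2) v ^ 2
      + beta (g + alpha v) e + (alpha / 2) w e + v e: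
    the cross terms between g and v complete the square of g + alpha v, and
    that square absorbs its own product with the forcing e.  The two other
    products with e are absorbed by Young's inequality, at the price of
    a w ^ 2 (with a as small as desired) and of half of the v ^ 2 term. *)
Lemma coord_dissipation alpha beta (a g u v e : R) :
  0 < alpha -> 0 <= beta -> 0 < a ->
  forall r, r = e - alpha * v - g ->
  g * (v + beta * r) + coord_energy_rate alpha beta u v r <=
  - (alpha / 2) * (g * (u + beta * v)) + a * (u + beta * v) ^+ 2
  - alpha / 4 * v ^+ 2
  + (beta / 4 + alpha ^+ 2 / (16 * a) + alpha^-1) * e ^+ 2.
Proof.
move=> al0 b0 a0 r rE; set w := u + beta * v.
have -> : g * (v + beta * r) + coord_energy_rate alpha beta u v r =
   - (alpha / 2) * (g * w) - beta * (g + alpha * v) ^+ 2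
   - (alpha / 2 + alpha ^+ 2 * beta / 2) * v ^+ 2
   + beta * ((g + alpha * v) * e) + alpha / 2 * (w * e) + v * e.
  by rewrite rE /w /coord_energy_rate; field.
have H1 : beta * ((g + alpha * v) * e) <=
    beta * (g + alpha * v) ^+ 2 + beta / 4 * e ^+ 2.
  have := mulr_ge0 b0 (sqr_ge0 (g + alpha * v - e / 2)); lra.
have H2 : alpha / 2 * (w * e) <= a * w ^+ 2 + alpha ^+ 2 / (16 * a) * e ^+ 2.
  have := mulr_ge0 (ltW a0) (sqr_ge0 (w - alpha / (4 * a) * e)).
  have -> : a * (w - alpha / (4 * a) * e) ^+ 2 =
    a * w ^+ 2 - alpha / 2 * (w * e) + alpha ^+ 2 / (16 * a) * e ^+ 2.
    by field; rewrite gt_eqF.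
  lra.
have H3 : v * e <= alpha / 4 * v ^+ 2 + alpha^-1 * e ^+ 2.
  have := mulr_ge0 (ltW al0) (sqr_ge0 (v / 2 - alpha^-1 * e)).
  have -> : alpha * (v / 2 - alpha^-1 * e) ^+ 2 =
     alpha / 4 * v ^+ 2 - v * e + alpha^-1 * e ^+ 2.
    by field; rewrite gt_eqF.
  lra.
have H4 : 0 <= alpha ^+ 2 * beta / 2 * v ^+ 2.
  by rewrite mulr_ge0 ?sqr_ge0// divr_ge0// mulr_ge0// sqr_ge0.
move: H1 H2 H3 H4; lra.
Qed.

Definition energy n alpha beta (F : R) (u v : 'rV[R]_n) : R :=
  F + \sum_(i < n) coord_energy alpha beta (u 0 i) (v 0 i).

Definition energy_rate n alpha beta (g u v r : 'rV[R]_n) : R :=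
  dotp g (v + beta *: r)
  + \sum_(i < n) coord_energy_rate alpha beta (u 0 i) (v 0 i) (r 0 i).

Lemma energy_coercive n alpha beta F (u v : 'rV[R]_n) :
  0 < alpha -> 0 <= beta ->
  F + alpha ^+ 2 / 16 * dotp u u + dotp v v / 6 <= energy alpha beta F u v.
Proof.
move=> a0 b0; rewrite -addrA lerD2l mulr_sumr mulr_suml -big_split/=.
by apply: ler_sum => i _; rewrite -!expr2; exact: coord_energy_coercive.
Qed.

(** One half of the hypothesis kappa F <= (g | w) is kept to dissipate F, the
    other half is turned by the growth hypothesis into a multiple of |w| ^ 2,
    which pays for the term a |w| ^ 2 of [coord_dissipation].  Then F, |w| ^ 2
    and |v| ^ 2 are all dissipated, and together they dominate the energy. *)
Lemma energy_dissipation n alpha beta gamma kappa :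
  0 < alpha -> 0 <= beta -> 0 < gamma -> 0 < kappa ->
  exists c, exists K, [/\ 0 < c, 0 <= K &
    forall (F : R) (g u v e : 'rV[R]_n),
      gamma / 8 * dotp (u + beta *: v) (u + beta *: v) <= F ->
      kappa * F <= dotp g (u + beta *: v) ->
      energy_rate alpha beta g u v (e - alpha *: v - g) <=
      - c * energy alpha beta F u v + K * dotp e e].
Proof.
move=> al0 b0 g0 k0.
have [A A0 EA] := coord_energy_le al0 b0.
(* half of alpha / 2 * (kappa / 2) * (gamma / 8), so that as much remains *)
pose a := alpha * kappa * gamma / 64.
have a0 : 0 < a by rewrite /a !mulr_gt0.
pose c := Num.min (alpha * kappa / 4) (Num.min (a / A) (alpha / 4 / A)).
have [c1 c2 c3] : [/\ c <= alpha * kappa / 4, c * A <= a & c * A <= alpha / 4].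
  by rewrite -!ler_pdivlMr// /c !ge_min !lexx !orbT.
have c0 : 0 < c by rewrite /c !lt_min !(divr_gt0, mulr_gt0).
exists c, (beta / 4 + alpha ^+ 2 / (16 * a) + alpha^-1); split=> //.
  by rewrite !addr_ge0// ?divr_ge0 ?invr_ge0 ?sqr_ge0 ?mulr_ge0 ?(ltW a0)// ltW.
set K := _ + _ + _ => F g u v e Fw gw; set w := u + beta *: v in Fw gw *.
have rate : energy_rate alpha beta g u v (e - alpha *: v - g) <=
   - (alpha / 2) * dotp g w + a * dotp w w - alpha / 4 * dotp v v + K * dotp e e.
  rewrite /energy_rate /dotp !mulr_sumr -!big_split/=.
  rewrite -sumrB -big_split/=; apply: ler_sum => i _.
  have := @coord_dissipation alpha beta a (g 0 i) (u 0 i) (v 0 i) (e 0 i)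
    al0 b0 a0 _ erefl.
  by rewrite /w !mxE -!expr2.
have upper : energy alpha beta F u v <= F + A * (dotp w w + dotp v v).
  rewrite lerD2l /dotp -big_split mulr_sumr; apply: ler_sum => i _.
  by have := EA (u 0 i) (v 0 i); rewrite /w !mxE -!expr2.
apply: (le_trans rate); rewrite lerD2r.
have Wge : 0 <= dotp w w := dotp_ge0 _; have Vge : 0 <= dotp v v := dotp_ge0 _.
have Fge : 0 <= F by apply: le_trans Fw; rewrite mulr_ge0// ltW// divr_gt0.
have := ler_wpM2l (ltW c0) upper.
have := ler_wpM2r Fge c1; have := ler_wpM2r Wge c2; have := ler_wpM2r Vge c3.
have := ler_wpM2l (ltW al0) gw.
have := ler_wpM2l (ltW (mulr_gt0 al0 k0)) Fw.
rewrite /a; lra.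
Qed.

End Energy.

(** Strong quasiconvexity at the midpoint of y and xs: f there is at least the
    minimum f xs and at most f y - (gamma / 8) |y - xs| ^ 2. *)
Lemma strongly_quasiconvex_growth (R : realType) n gamma (f : 'rV[R]_n -> R)
    xs y :
  strongly_quasiconvex gamma f -> argmin f xs ->
  gamma / 8 * dotp (y - xs) (y - xs) <= f y - f xs.
Proof.
move=> /(_ y xs 2^-1) /(_ ltac:(lra)) + fmin.
rewrite enorm_sqr max_r ?fmin// => fmid.
have := fmin (2^-1 *: xs + (1 - 2^-1) *: y); lra.
Qed.

(** * Derivatives along a trajectory *)

Section Derivatives.
Context {R : realType} {n : nat}.
Implicit Types (x y : R -> 'rV[R]_n) (t : R).

(** Strictly after the initial time, the restriction to times past t0 is void
    near t, so the one-sided notion is the usual derivative. *)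
Lemma is_derive_from x (t0 t : R) :
  t0 < t -> cvg (diff_quotient_from t0 x t) ->
  is_derive t 1 x (derive_from t0 x t).
Proof.
move=> t0t xl; set l := derive_from t0 x t.
suff xl' : h^-1 *: (x (h *: 1 + t) - x t) @[h --> 0^'] --> l.
  by apply: DeriveDef; [apply/cvg_ex; exists l|apply: cvg_lim].
apply/cvgrPdist_le => e e0.
move/cvgrPdist_le : xl => /(_ e e0).
rewrite /diff_quotient_from => -[r /= r0 rP].
exists (Num.min r (t - t0)); first by rewrite /= lt_min r0 subr_gt0.
move=> h; rewrite /= sub0r normrN lt_min => /andP[hr ht] h0.
have := rP (h%:A + t).
have -> : h%:A = h by rewrite /GRing.scale/= mulr1.
rewrite addrK; apply.
- by rewrite /= opprD addrCA subrr addr0 normrN.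
- by rewrite -subr_eq0 addrK.
- rewrite in_itv/= andbT -lerBlDr; apply: ltW; move: ht; rewrite ltr_norml.
  by rewrite opprB => /andP[].
Qed.

Lemma is_derive_coord x (dx : 'rV[R]_n) t i :
  is_derive t 1 x dx -> is_derive t 1 (fun s => x s 0 i) (dx 0 i).
Proof.
move=> [xt <-]; have /derivable_mxP xti := xt.
by rewrite (derive_mx xt) mxE; exact: derivableP.
Qed.

Lemma diff_gradient (f : 'rV[R]_n -> R) p (d : 'rV[R]_n) :
  differentiable f p -> 'd f p d = dotp (gradient f p) d.
Proof.
move=> fp; rewrite [in LHS](row_sum_delta d) linear_sum.
by apply: eq_bigr => i _; rewrite linearZ /= -deriveE// mxE mulrC.
Qed.

Lemma is_derive_comp_gradient (f : 'rV[R]_n -> R) y (dy : 'rV[R]_n) t :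
  differentiable f (y t) -> is_derive t 1 y dy ->
  is_derive t 1 (f \o y) (dotp (gradient f (y t)) dy).
Proof.
move=> fy [/derivable1_diffP yt <-].
have fyt : differentiable (f \o y) t by exact: differentiable_comp.
apply: DeriveDef; first exact/derivable1_diffP.
by rewrite !deriveE// diff_comp//= diff_gradient.
Qed.

Lemma dotp_continuous : continuous (fun u : 'rV[R]_n => dotp u u).
Proof.
move=> u; apply: (@continuous_big _ _ +%R) => [|i _].
  exact: add_continuous.
move=> {}u; apply: (@continuousM _ _ (fun v : 'rV[R]_n => v 0 i)
  (fun v : 'rV[R]_n => v 0 i)); exact: coord_continuous.
Qed.

End Derivatives.

Lemma is_derive_quadratic (R : realType) (k1 k2 k3 : R) (p q : R -> R)
    (dp dq t : R) :
  is_derive t 1 p dp -> is_derive t 1 q dq ->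
  is_derive t 1 (fun s => k1 * p s ^+ 2 + k2 * (p s * q s) + k3 * q s ^+ 2)
    (k1 * (2 * p t * dp) + k2 * (p t * dq + q t * dp) + k3 * (2 * q t * dq)).
Proof.
move=> pdp qdq; have p2 := is_deriveX 2 pdp; have q2 := is_deriveX 2 qdq.
have pq := is_deriveM pdp qdq.
exact: is_deriveD (is_deriveD (is_deriveZ k1 p2) (is_deriveZ k2 pq))
  (is_deriveZ k3 q2).
Qed.

Lemma is_derive_coord_energy (R : realType) alpha beta (p q : R -> R)
    (dq t : R) :
  is_derive t 1 p (q t) -> is_derive t 1 q dq ->
  is_derive t 1 (fun s => coord_energy alpha beta (p s) (q s))
    (coord_energy_rate alpha beta (p t) (q t) dq).
Proof.
move=> pq qdq; have := is_derive_quadratic (alpha ^+ 2 / 4) (alpha / 2)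
  ((1 + alpha * beta + alpha * beta / 2) / 2) pq qdq.
rewrite /coord_energy /coord_energy_rate; set d := (X in is_derive _ _ _ X).
set d' := (X in _ -> is_derive _ _ _ X); suff -> : d = d' by [].
by rewrite /d /d'; lra.
Qed.

Lemma is_derive_energy (R : realType) n (f : 'rV[R]_n -> R) alpha beta m xs
    (x v : R -> 'rV[R]_n) (r : 'rV[R]_n) (t : R) :
  differentiable f (x t + beta *: v t) ->
  is_derive t 1 x (v t) -> is_derive t 1 v r ->
  is_derive t 1
    (fun s => energy alpha beta (f (x s + beta *: v s) - m) (x s - xs) (v s))
    (energy_rate alpha beta (gradient f (x t + beta *: v t)) (x t - xs) (v t) r).
Proof.
move=> fy xv vr.
have yd : is_derive t 1 (fun s => x s + beta *: v s) (v t + beta *: r).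
  exact: is_deriveD.
have Fd := is_derive_comp_gradient fy yd.
have qd i : is_derive t 1
    (fun s => coord_energy alpha beta ((x s - xs) 0 i) (v s 0 i))
    (coord_energy_rate alpha beta ((x t - xs) 0 i) (v t 0 i) (r 0 i)).
  have ud : is_derive t 1 (fun s => x s - xs) (v t).
    by rewrite -[X in is_derive _ _ _ X]subr0; exact: is_deriveB.
  exact: is_derive_coord_energy (is_derive_coord i ud) (is_derive_coord i vr).
rewrite /energy_rate -[dotp _ _]subr0.
rewrite (_ : (fun s => _) = (f \o (fun s => x s + beta *: v s)) - cst m +
  \sum_(i < n) (fun s => coord_energy alpha beta ((x s - xs) 0 i) (v s 0 i))).
  exact: is_deriveD.
by apply/funext => s; rewrite /energy /= !fctE fct_sumE.
Qed.

Lemma solution_is_derive (R : realType) (n : nat) (f : 'rV[R]_n -> R)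
    (alpha beta t0 : R) (eps x : R -> 'rV[R]_n) t :
  is_solution f alpha beta t0 eps x -> t0 < t ->
  is_derive t 1 x (derive_from t0 x t).
Proof.
case=> -[x_d _ _] _ tt.
by apply: is_derive_from => //; exact/x_d/ltW.
Qed.

Lemma solution_is_derive2 (R : realType) (n : nat) (f : 'rV[R]_n -> R)
    (alpha beta t0 : R) (eps x : R -> 'rV[R]_n) t :
  is_solution f alpha beta t0 eps x -> t0 < t ->
  is_derive t 1 (derive_from t0 x) (derive_from t0 (derive_from t0 x) t).
Proof.
case=> -[_ v_d _] _ tt.
by apply: is_derive_from => //; exact/v_d/ltW.
Qed.

(** The equation expresses the forcing through x'', x' and the gradient, which
    are continuous. *)
Lemma forcing_continuous (R : realType) (n : nat) (f : 'rV[R]_n -> R)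
    (alpha beta t0 : R) (eps x : R -> 'rV[R]_n) :
  is_solution f alpha beta t0 eps x -> continuous (gradient f) ->
  {in `]t0, +oo[, continuous eps}.
Proof.
move=> x_sol f_grad t tT; have tt : t0 < t by move: tT; rewrite in_itv/= andbT.
have [[_ _ a_cont] x_eq] := x_sol.
have xv := solution_is_derive x_sol tt; have va := solution_is_derive2 x_sol tt.
move: xv va a_cont x_eq.
move: (derive_from t0 x) (derive_from t0 (derive_from t0 x)) => v a.
move=> [xv _] [va _] a_cont x_eq.
have xc : {for t, continuous x} :=
  differentiable_continuous ((derivable1_diffP _ _).1 xv).
have vc : {for t, continuous v} :=
  differentiable_continuous ((derivable1_diffP _ _).1 va).
have ac : {for t, continuous a}.
  have : {within `]t0, +oo[, continuous a}.
    by apply: continuous_subspaceW a_cont; apply: subset_itvr; rewrite bnd_simp.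
  rewrite (continuous_open_subspace _ (@interval_open _ _ _ _ _))//.
  by apply; rewrite inE.
have yc := continuousD xc (continuousZl_tmp (k := beta) vc).
have gc := continuous_comp yc (f_grad _).
have ec := continuousD (continuousD ac (continuousZl_tmp (k := alpha) vc)) gc.
rewrite /continuous_at -x_eq ?(ltW tt)//; apply: cvg_trans ec.
apply: near_eq_cvg; near=> s; rewrite -x_eq//.
by apply: ltW; near: s; exact: lt_nbhsr.
Unshelve. all: by end_near. Qed.

(** * From the energy to norms and rates *)

Lemma squeeze_cvg0 (R : realType) (E a : R -> R) (t0 k : R) :
  (forall t, t0 < t -> 0 <= a t <= k * E t) ->
  E t @[t --> +oo] --> 0 -> a t @[t --> +oo] --> 0.
Proof.
move=> aE E0; apply: (@squeeze_cvgr _ _ _ _ (cst 0) (fun t => k * E t)).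
- by near=> t; apply: aE; near: t; apply: nbhs_pinfty_gt; exact: num_real.
- exact: cvg_cst.
- by rewrite -[X in _ --> X](mulr0 k); apply: cvgMr.
Unshelve. all: by end_near. Qed.

Lemma enorm_cvg0 (R : realType) n (u : R -> 'rV[R]_n) :
  dotp (u t) (u t) @[t --> +oo] --> 0 -> enorm (u t) @[t --> +oo] --> 0.
Proof.
move=> u0; rewrite -[X in _ --> X](@sqrtr0 R).
by apply: (cvg_comp _ _ u0); exact: sqrt_continuous.
Qed.

Lemma eqO_powRVP (R : realType) (a : R -> R) (q : R) :
  a =O_ +oo (fun t => (t `^ q)^-1) <->
  exists M, \forall t \near +oo, `|a t| <= M * (t `^ q)^-1.
Proof.
split=> [/eqO_exP[M _ aM]|[M aM]].
  exists M; apply: filterS aM => t.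
  by rewrite (ger0_norm (_ : 0 <= (t `^ q)^-1)) ?invr_ge0 ?powR_ge0.
apply/eqO_exP; exists (`|M| + 1); first by rewrite ltr_wpDl.
apply: filterS aM => t /le_trans; apply.
rewrite (ger0_norm (_ : 0 <= (t `^ q)^-1)) ?invr_ge0 ?powR_ge0//.
by rewrite ler_wpM2r ?invr_ge0 ?powR_ge0// (le_trans (ler_norm M))// lerDl.
Qed.

(** Squaring makes the rate for a vector comparable with that of the energy. *)
Lemma enorm_eqOP (R : realType) n (u : R -> 'rV[R]_n) (p : R) : 0 < p ->
  (fun t => enorm (u t)) =O_ +oo (fun t => (t `^ p)^-1) <->
  (fun t => dotp (u t) (u t)) =O_ +oo (fun t => (t `^ (2 * p))^-1).
Proof.
move=> p0.
have sq t : (t `^ (2 * p))^-1 = ((t `^ p)^-1) ^+ 2.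
  rewrite mulr_natl mulr2n powRD ?expr2 ?invfM//.
  by rewrite gt_eqF// addr_gt0.
split=> /eqO_powRVP[M uM]; apply/eqO_powRVP.
  exists (M ^+ 2); apply: filterS uM => t.
  rewrite !ger0_norm ?dotp_ge0 ?sqrtr_ge0// sq -exprMn -enorm_sqr => uM.
  by rewrite lerXn2r// nnegrE ?sqrtr_ge0// (le_trans _ uM)// sqrtr_ge0.
exists (Num.sqrt `|M|); apply: filterS uM => t.
rewrite (ger0_norm (dotp_ge0 _)) (ger0_norm (sqrtr_ge0 _)) sq => uM.
have -> : Num.sqrt `|M| * (t `^ p)^-1 = Num.sqrt (`|M| * (t `^ p)^-1 ^+ 2).
  by rewrite sqrtrM// sqrtr_sqr (@ger0_norm _ (t `^ p)^-1)// invr_ge0 powR_ge0.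
rewrite ler_wsqrtr// (le_trans uM)// ler_wpM2r ?sqr_ge0// ler_norm//.
Qed.

(** * Convergence of solutions *)

Unset Implicit Arguments.

Theorem theorem3p2 (R : realType) (n : nat) (f : 'rV[R]_n -> R)
    (gamma kappa alpha beta t0 : R) (xstar : 'rV[R]_n)
    (eps x : R -> 'rV[R]_n)
    (f_C1 : continuously_differentiable f)
    (gamma_gt0 : 0 < gamma)
    (f_sqc : strongly_quasiconvex gamma f)
    (xstar_argmin : argmin f xstar)
    (kappa_gt0 : 0 < kappa)
    (f_kappa : forall y : 'rV[R]_n,
      kappa * (f y - f xstar) <= dotp (gradient f y) (y - xstar))
    (eps_L2 : (\int[lebesgue_measure]_(t in `[t0, +oo[)
      (enorm (eps t) ^+ 2)%:E < +oo)%E)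
    (alpha_gt0 : 0 < alpha)
    (alpha_le : alpha <= (kappa + 4) / 4 * Num.sqrt (gamma / (2 * kappa)))
    (beta_ge0 : 0 <= beta)
    (beta_le : beta <=
      (Num.sqrt (2 * alpha ^+ 2 * (kappa + 2) ^+ 4
                 + 27 * gamma * (kappa + 4) ^+ 3)
       - Num.sqrt 2 * alpha * (kappa + 2) ^+ 2)
      / (9 * Num.sqrt 2 * gamma * (kappa + 4)))
    (x_sol : is_solution f alpha beta t0 eps x) :
  [/\ f (x t + beta *: derive_from t0 x t) @[t --> +oo] --> f xstar,
      enorm (x t - xstar) @[t --> +oo] --> 0 &
      enorm (derive_from t0 x t) @[t --> +oo] --> 0] /\
  (forall p : R, 0 < p ->
    (fun t => enorm (eps t)) =O_ +oo (fun t => (t `^ p)^-1) ->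
    [/\ (fun t => f (x t + beta *: derive_from t0 x t) - f xstar)
          =O_ +oo (fun t => (t `^ (2 * p))^-1),
        (fun t => enorm (x t - xstar)) =O_ +oo (fun t => (t `^ p)^-1) &
        (fun t => enorm (derive_from t0 x t))
          =O_ +oo (fun t => (t `^ p)^-1)]).
Proof.
have [f_diff f_grad] := f_C1.
have xv := solution_is_derive x_sol; have va := solution_is_derive2 x_sol.
have eps_cont := forcing_continuous x_sol f_grad; have [_ x_eq] := x_sol.
set v := derive_from t0 x in xv va x_eq *.
set a := derive_from t0 v in va x_eq.
pose y t := x t + beta *: v t.
pose u t := x t - xstar.
pose F t := f (y t) - f xstar.
pose E t := energy alpha beta (F t) (u t) (v t).
clearbody a v.
have uy t : u t + beta *: v t = y t - xstar by rewrite /u /y addrAC.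
have F_growth t : gamma / 8 * dotp (u t + beta *: v t) (u t + beta *: v t) <= F t.
  by rewrite uy; exact: strongly_quasiconvex_growth.
have F_kappa t : kappa * F t <= dotp (gradient f (y t)) (u t + beta *: v t).
  by rewrite uy; exact: f_kappa.
have F0 t : 0 <= F t by rewrite subr_ge0; exact: xstar_argmin.
have E_coercive t : F t + alpha ^+ 2 / 16 * dotp (u t) (u t) + dotp (v t) (v t) / 6
    <= E t by exact: energy_coercive.
have k0 : 0 < alpha ^+ 2 / 16 by rewrite divr_gt0// exprn_gt0.
have FE t : 0 <= F t <= 1 * E t.
  rewrite F0 mul1r (le_trans _ (E_coercive t))// -addrA lerDl.
  by rewrite addr_ge0 ?divr_ge0 ?mulr_ge0 ?dotp_ge0// ltW.
have uE t : 0 <= dotp (u t) (u t) <= (alpha ^+ 2 / 16)^-1 * E t.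
  rewrite dotp_ge0 mulrC ler_pdivlMr// mulrC (le_trans _ (E_coercive t))//.
  by rewrite addrAC lerDr addr_ge0 ?divr_ge0 ?dotp_ge0.
have vE t : 0 <= dotp (v t) (v t) <= 6 * E t.
  rewrite dotp_ge0 mulrC -ler_pdivrMr// (le_trans _ (E_coercive t))//.
  by rewrite lerDr addr_ge0// (mulr_ge0 (ltW k0) (dotp_ge0 _)).
have E0 t : 0 <= E t by have /andP[H1 H2] := FE t; lra.
have [c [K [c0 K0 diss]]] :=
  energy_dissipation n alpha_gt0 beta_ge0 gamma_gt0 kappa_gt0.
pose dE t := energy_rate alpha beta (gradient f (y t)) (u t) (v t) (a t).
have EdE t : t0 < t -> is_derive t 1 E (dE t).
  move=> tt.
  exact: (is_derive_energy alpha (f xstar) xstar (f_diff _) (xv _ tt) (va _ tt)).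
have dEle t : t0 < t -> dE t <= - c * E t + K * dotp (eps t) (eps t).
  move=> tt; rewrite /dE.
  have -> : a t = eps t - alpha *: v t - gradient f (y t).
    by rewrite -x_eq ?(ltW tt)// addrAC addrK addrK.
  exact: diss.
have [H [B [HdH HB]]] : exists H : R -> R, exists B,
    (forall t, t0 < t -> is_derive t 1 H (dotp (eps t) (eps t))) /\
    (forall t, t0 < t -> H t <= B).
  apply: bounded_primitive_on_ray => [t|t _|].
  - move=> tt; exact: continuous_comp (eps_cont _ tt) (@dotp_continuous R n _).
  - exact: dotp_ge0.
  - by under eq_integral do rewrite -enorm_sqr.
split=> [|p p0 /(enorm_eqOP _ p0)/eqO_powRVP[M epsM]].
  have E_cvg : E t @[t --> +oo] --> 0.
    apply: (dissipation_cvg0 c0 K0 _ _ EdE HdH HB dEle) => // t _.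
    exact: dotp_ge0.
  have cvg0 b k : (forall t, 0 <= b t <= k * E t) -> b t @[t --> +oo] --> 0.
    by move=> bE; apply: (squeeze_cvg0 (t0 := t0) _ E_cvg) => t _; exact: bE.
  split; [|exact/enorm_cvg0/(cvg0 _ _ uE)|exact/enorm_cvg0/(cvg0 _ _ vE)].
  exact/subr_cvg0/(cvg0 _ _ FE).
have [|M' EM'] := dissipation_bigO (N := fun t => dotp (eps t) (eps t))
  (M := M) (q := 2 * p) c0 K0 (fun t _ => E0 t) EdE dEle.
  by apply: filterS epsM => t; apply: le_trans; exact: ler_norm.
have bigO b k : 0 <= k -> (forall t, 0 <= b t <= k * E t) ->
    b =O_ +oo (fun t => (t `^ (2 * p))^-1).
  move=> kge0 bE; apply/eqO_powRVP; exists (k * M'); apply: filterS EM' => t EtM.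
  have /andP[b0 bEt] := bE t; rewrite ger0_norm// (le_trans bEt)//.
  by rewrite -mulrA ler_wpM2l.
split; first exact: bigO FE.
- by apply/(enorm_eqOP _ p0)/(bigO _ _ _ uE); rewrite invr_ge0 ltW.
- exact/(enorm_eqOP _ p0)/(bigO _ _ _ vE).
Qed.
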